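(* Let $\mathcal A,\mathcal B\in\mathbb{C}^{I_1\times\cdots\times I_N\times I_1\times\cdots\times I_N}$ be random positive definite tensors and let $\mathcal X\in\mathbb{C}^{I_1\times\cdots\times I_N\times I_1\times\cdots\times I_N}$ be a Hermitian tensor. For every $0\le\nu\le1$, every two nonnegative real numbers $r_0,r_1$ satisfying $r_0+r_1=1$, and every $\theta>0$, $$\Pr\left(\left\|[\mathcal A|\mathcal A|^{-\nu},\mathcal B]\right\|\ge\theta\right)\le\frac{(\mathbb{I}_1^N)^2}{\theta}\left[\min_{c>0}\left(\sqrt{2c}\,\|g(t)\|_2+\sqrt{2/c}\,\|g'(t)\|_2\right)\right]\mathbb{E}\left(\left\||\mathcal A|^{-r_0\nu}\star_N[\mathcal A,\mathcal B]\star_N|\mathcal A|^{-r_1\nu}\right\|\right),$$ where $$g(t)=\frac{\exp\left[\frac{(1-2r_1\nu)t}{2}\right]-\exp\left[\frac{(2r_0\nu-1)t}{2}\right]}{\exp\left(\frac t2\right)-\exp\left(\frac{-t}2\right)} .$$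
   Context: $\mathbb{I}_1^N=I_1\cdots I_N$. For square tensors the Einstein product is $(\mathcal X\star_N\mathcal Y)_{i_1\ldots i_N,k_1\ldots k_N}=\sum_{j_1,\ldots,j_N}x_{i_1\ldots i_N,j_1\ldots j_N}y_{j_1\ldots j_N,k_1\ldots k_N}$; $\mathcal A|\mathcal A|^{-\nu}$ denotes $\mathcal A\star_N|\mathcal A|^{-\nu}$. $|\mathcal A|=\sqrt{\mathcal A^H\star_N\mathcal A}$, and $[\mathcal A,\mathcal B]=\mathcal A\star_N\mathcal B-\mathcal B\star_N\mathcal A$. Every Hermitian tensor has an eigen-decomposition $\mathcal H=\sum_{i=1}^{\mathbb{I}_1^N}\lambda_i\mathcal P_i$ with real $\lambda_i$ and $\mathcal P_i=\mathcal U_i\star_1\mathcal U_i^H$, the $\mathcal U_i\in\mathbb{C}^{I_1\times\cdots\times I_N\times1}$ orthonormal; it is positive definite if all $\lambda_i>0$, and then $\mathcal H^p=\sum_i\lambda_i^p\mathcal P_i$ for real $p$. $\|\cdot\|$ on tensors is the spectral norm (largest singular value); $\|\cdot\|_2$ on functions is the $L^2(\mathbb{R})$ norm; $g'$ is the derivative of $g$, and $g(0)$ is defined by continuity. *)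

(* Defs.v *)
From HB Require Import structures.
From mathcomp Require Import all_boot all_order all_algebra.
From mathcomp Require Import all_classical all_reals all_analysis.
From mathcomp.real_closed Require Import complex.

Set Implicit Arguments.
Unset Strict Implicit.
Unset Printing Implicit Defensive.

Import Order.TTheory GRing.Theory Num.Theory.
Import numFieldNormedType.Exports.

Local Open Scope classical_set_scope.
Local Open Scope ring_scope.

(* A shape I_1 x ... x I_N is a function I : 'I_N -> nat, and a tensor of
   C^(I_1 x ... x I_N x J_1 x ... x J_M) is indexed by pairs of multi-indices;
   square tensors are the case J = I. *)
Definition midx (N : nat) (I : 'I_N -> nat) := {dffun forall k, 'I_(I k)}.
HB.instance Definition _ (N : nat) (I : 'I_N -> nat) := 
  Finite.copy (midx I) {dffun forall k, 'I_(I k)}.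

Definition tensor (R : realType) (M N : nat)
    (I : 'I_M -> nat) (J : 'I_N -> nat) := {ffun midx I * midx J -> R[i]}.
HB.instance Definition _ (R : realType) (M N : nat)
    (I : 'I_M -> nat) (J : 'I_N -> nat) := 
  GRing.Lmodule.copy (tensor R I J) {ffun midx I * midx J -> R[i]}.

(* The trailing mode of length 1 of C^(I_1 x ... x I_N x 1). *)
Definition unit_shape : 'I_1 -> nat := fun=> 1%N.

Definition dimprod (N : nat) (I : 'I_N -> nat) : nat := (\prod_(k < N) I k)%N.

Section Tensor.
Variable R : realType.

(* The number of contracted modes is the length M of the middle shape J: this
   is both the product star_N of square tensors (J = I) and the product star_1
   of U with U^H (J = unit_shape). *)
Definition einstein (L M N : nat)
    (I : 'I_L -> nat) (J : 'I_M -> nat) (K : 'I_N -> nat)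
    (X : tensor R I J) (Y : tensor R J K) : tensor R I K :=
  [ffun ik => \sum_(j : midx J) X (ik.1, j) * Y (j, ik.2)].

Definition ctransp (M N : nat) (I : 'I_M -> nat) (J : 'I_N -> nat)
    (X : tensor R I J) : tensor R J I :=
  [ffun ji => (X (ji.2, ji.1))^*].

Section Square.
Variables (N : nat) (I : 'I_N -> nat).

Definition commutator (X Y : tensor R I I) : tensor R I I :=
  einstein X Y - einstein Y X.

Definition hermitian_tensor (H : tensor R I I) : Prop := ctransp H = H.

Notation eigendata :=
  ({ffun 'I_(dimprod I) -> R} *
   {ffun 'I_(dimprod I) -> tensor R I unit_shape})%type.

Definition spectral_sum (f : R -> R) (lU : eigendata) : tensor R I I :=
  \sum_(i < dimprod I)
    (f (lU.1 i))%:C%C *: einstein (lU.2 i) (ctransp (lU.2 i)).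

Definition is_eigendecomposition (H : tensor R I I) (lU : eigendata) : Prop :=
  (forall i j, einstein (ctransp (lU.2 i)) (lU.2 j) = [ffun=> (i == j)%:R])
  /\ H = spectral_sum id lU.

(* A chosen eigen-decomposition.  Every Hermitian tensor has one; the value
   [ffun=> 0] is only reached for non-Hermitian tensors. *)
Definition eigendecomposition (H : tensor R I I) : eigendata :=
  xget ([ffun=> 0], [ffun=> 0]) [set lU | is_eigendecomposition H lU].

Definition eigenvalue_tensor (H : tensor R I I) (i : 'I_(dimprod I)) : R :=
  (eigendecomposition H).1 i.

Definition posdef (H : tensor R I I) : Prop :=
  hermitian_tensor H /\ forall i, 0 < eigenvalue_tensor H i.

Definition tpow (H : tensor R I I) (p : R) : tensor R I I :=
  spectral_sum (fun x => x `^ p) (eigendecomposition H).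

Definition tsqrt (H : tensor R I I) : tensor R I I :=
  spectral_sum Num.sqrt (eigendecomposition H).

Definition tabs (X : tensor R I I) : tensor R I I :=
  tsqrt (einstein (ctransp X) X).

Definition singular_value (X : tensor R I I) (i : 'I_(dimprod I)) : R :=
  Num.sqrt (eigenvalue_tensor (einstein (ctransp X) X) i).

Definition spectral_norm (X : tensor R I I) : R :=
  \big[Num.max/0]_(i < dimprod I) singular_value X i.

(* Measurability for the Borel sets of C^(I x I) = R^(2 |I|^2). *)
Definition random_tensor (d : measure_display) (Omega : measurableType d)
    (A : Omega -> tensor R I I) : Prop :=
  forall ij, measurable_fun setT (fun w => complex.Re (A w ij)) /\
             measurable_fun setT (fun w => complex.Im (A w ij)).

End Square.

Definition g_quotient (r0 r1 nu t : R) : R :=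
  (expR ((1 - 2 * r1 * nu) * t / 2) - expR ((2 * r0 * nu - 1) * t / 2)) /
  (expR (t / 2) - expR (- t / 2)).

Definition g (r0 r1 nu t : R) : R :=
  if t == 0 then lim (g_quotient r0 r1 nu x @[x --> 0^'])
  else g_quotient r0 r1 nu t.

(* Extended-real valued: the L^2 norms are +oo for some parameters, e.g. when
   nu = 0, where g is constantly 1. *)
Definition g_bound (r0 r1 nu c : R) : \bar R :=
  ((Num.sqrt (2 * c))%:E * 'N[lebesgue_measure]_(2%:E) [EFin \o g r0 r1 nu] +
   (Num.sqrt (2 / c))%:E
     * 'N[lebesgue_measure]_(2%:E) [EFin \o derive1 (g r0 r1 nu)])%E.

Definition is_minimum (S : set (\bar R)) (m : \bar R) : Prop :=
  S m /\ lbound S m.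

End Tensor.

Notation "X ⋆ Y" := (einstein X Y) (at level 40, left associativity).

(* Main.v *)
Require Import Defs.
From HB Require Import structures.
From mathcomp Require Import all_boot all_order all_algebra.
From mathcomp Require Import all_classical all_reals all_analysis.
From mathcomp.real_closed Require Import complex.
From mathcomp Require Import measurable_realfun ring lra.

Set Implicit Arguments.
Unset Strict Implicit.
Unset Printing Implicit Defensive.

Import Order.TTheory GRing.Theory Num.Theory.
Import numFieldNormedType.Exports.

Local Open Scope classical_set_scope.
Local Open Scope ring_scope.

(** Since [A] is positive definite, [|A| = A].  Let [a_i] be the eigenvalues of
    [A], and write [b_ij] for the entries of [B] in an orthonormal eigenbasis of
    [A].  In that basis the two tensors of the theorem have the entries
      [y_ij = (a_i `^ (1 - nu) - a_j `^ (1 - nu)) * b_ij],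
      [z_ij = a_i `^ (- r0 nu) * (a_i - a_j) * a_j `^ (- r1 nu) * b_ij],
    and [y_ij = g (ln a_i - ln a_j) * z_ij] whenever [a_i != a_j], by the
    definition of [g] ([powR_divided_difference]).  So if [`|g t| <= G] for all
    [t != 0], then [y] is at most [G] times [z] in Frobenius norm.  The Frobenius
    norm lies between the spectral norm and [sqrt n] times it, where [n] is the
    dimension, so that [`|y| <= sqrt n * G * `|z|] in spectral norm
    ([commutator_spectral_norm_le]).  The factor [n ^ 2] of the theorem leaves
    room for [sqrt n].

    It remains to bound [g] pointwise by the stated combination of its [L^2]
    norms.  On an interval of length [h], some value of [`|g|] is at most
    [h ^ (- 1 / 2)] times the [L^2] norm of [g], and by the fundamental theorem
    of calculus and the Cauchy-Schwarz inequality [g] varies by at most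
    [h ^ (1 / 2)] times the [L^2] norm of its derivative.  Taking [h = 1 / c]
    gives [`|g t| <= g_bound c] for every [c > 0] ([g_le_g_bound]).  For
    [t != 0] the interval can be chosen on the side of [t], away from the
    removable singularity of [g] at [0].  The minimum over [c] is attained
    ([g_bound_minimum]): if both norms are positive and finite, by the inequality
    of arithmetic and geometric means; if one is infinite, every value is
    infinite; and if one vanishes, the pointwise bound forces [g] to vanish.  If the
    minimum is infinite, the bound [`|g| <= 1] replaces it
    ([g_quotient_norm_le1]): the right-hand side of the theorem could still be
    [+oo * 0 = 0], and then the probability must be shown to be [0].

    Integrating the pointwise bound is Markov's inequality
    ([tail_le_expectation]).  It requires the norms to be measurable functions of
    the outcome, although the eigen-decompositions are chosen with no regard to
    measurability.  The functions [f] for which [f (H w)] is measurable in [w],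
    for a random Hermitian tensor [H], contain the polynomials and are closed
    under products and pointwise limits, so they contain the exponentials, the
    indicators of rays and hence of Borel sets, and all nonnegative Borel
    functions ([calculable_ge0]).  This gives the powers of [A]; and the spectral
    norm of [X] is at least [r > 0] exactly when the spectral projection of
    [X^H X] for the half-line [r ^ 2 <= x] has a positive trace
    ([measurable_spectral_norm]). *)

(** * Unitary conjugates of real diagonal matrices *)

Section SquaredModulus.
Variable R : realType.

(** The norm of [R[i]] takes its values in [R[i]]; this one is real-valued, so
    that it can be compared with squared singular values. *)
Definition sqmod (z : R[i]) : R := complex.Re z ^+ 2 + complex.Im z ^+ 2.

Lemma sqmod_ge0 z : 0 <= sqmod z.
Proof. by rewrite addr_ge0 ?sqr_ge0. Qed.

Lemma sqmodE z : (sqmod z)%:C%C = z^* * z.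
Proof. by rewrite /sqmod add_Re2_Im2 mulrC normCK. Qed.

Lemma sqmodM a b : sqmod (a * b) = sqmod a * sqmod b.
Proof.
case: a b => [a1 a2] [b1 b2]; rewrite /sqmod /=; ring.
Qed.

Lemma sqmod_real (x : R) : sqmod x%:C%C = x ^+ 2.
Proof. by rewrite /sqmod /= expr0n addr0. Qed.

Lemma conjC_real_complex (x : R) : (x%:C%C)^* = x%:C%C :> R[i].
Proof. exact: conjc_real. Qed.

End SquaredModulus.

Section Unitary.
Local Open Scope sesquilinear_scope.
Variables (R : realType) (n : nat).
Implicit Types (M V : 'M[R[i]]_n) (l : 'I_n -> R).

(** The square of the Frobenius norm. *)
Definition frob2 M : R := \sum_i \sum_j sqmod (M i j).

Lemma frob2_ge0 M : 0 <= frob2 M.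
Proof. by apply: sumr_ge0 => i _; apply: sumr_ge0 => j _; exact: sqmod_ge0. Qed.

Lemma frob2_trace M : (frob2 M)%:C%C = \tr (M^t* *m M).
Proof.
rewrite /frob2 exchange_big raddf_sum; apply: eq_bigr => j _ /=.
rewrite !mxE raddf_sum; apply: eq_bigr => i _ /=.
by rewrite sqmodE !mxE.
Qed.

Lemma frob2_unitary V M : V^t* *m V = 1%:M ->
  frob2 (V *m M *m V^t*) = frob2 M.
Proof.
move=> VV; apply: complexI; rewrite !frob2_trace !trmx_mul !map_mxM trmxCK.
rewrite !mulmxA mxtrace_mulC !mulmxA VV mul1mx -!mulmxA (mulmxA (V^t*)) VV.
by rewrite mul1mx.
Qed.

Definition rdiag l : 'M[R[i]]_n := diag_mx (\row_k (l k)%:C%C).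

(** For unitary [V], the matrix with eigenvectors the columns of [V] and
    eigenvalues [l]. *)
Definition conj_diag V l : 'M[R[i]]_n := V *m rdiag l *m V^t*.

Lemma rdiagM l1 l2 : rdiag l1 *m rdiag l2 = rdiag (fun k => l1 k * l2 k).
Proof.
rewrite mulmx_diag; congr diag_mx; apply/rowP => k.
by rewrite !mxE rmorphM.
Qed.

Lemma conj_diagM V l1 l2 : V^t* *m V = 1%:M ->
  conj_diag V l1 *m conj_diag V l2 = conj_diag V (fun k => l1 k * l2 k).
Proof.
move=> VV; rewrite /conj_diag -!mulmxA (mulmxA (V^t*)) VV mul1mx.
by rewrite (mulmxA (rdiag l1)) rdiagM !mulmxA.
Qed.

Lemma conj_diag_ctransp V l : (conj_diag V l)^t* = conj_diag V l.
Proof.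
rewrite /conj_diag !trmx_mul !map_mxM trmxCK tr_diag_mx map_diag_mx -mulmxA.
congr (_ *m (diag_mx _ *m _)); apply/rowP => k.
by rewrite !mxE; exact: conjC_real_complex.
Qed.

Lemma conj_diag_trace V l : V^t* *m V = 1%:M ->
  \tr (conj_diag V l) = (\sum_k l k)%:C%C.
Proof.
move=> VV; rewrite mxtrace_mulC mulmxA VV mul1mx mxtrace_diag raddf_sum.
by apply: eq_bigr => k _; rewrite mxE.
Qed.

(** The unitary [W^* V] intertwines the two diagonal matrices, so its entries
    linking distinct eigenvalues vanish; hence it also intertwines their images
    under [f].  This makes the functional calculus independent of the chosen
    eigen-decomposition. *)
Lemma conj_diag_uniq V W l m (f : R -> R) :
    V^t* *m V = 1%:M -> W^t* *m W = 1%:M ->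
    conj_diag V l = conj_diag W m ->
  conj_diag V (f \o l) = conj_diag W (f \o m).
Proof.
move=> VV WW VlWm.
have VV' : V *m V^t* = 1%:M by exact: mulmx1C.
have WW' : W *m W^t* = 1%:M by exact: mulmx1C.
have QlQ (h : R -> R) : conj_diag V (h \o l) = conj_diag W (h \o m) <->
    W^t* *m V *m rdiag (h \o l) = rdiag (h \o m) *m (W^t* *m V).
  split=> [E|E].
    have := congr1 (fun M => W^t* *m M *m V) E; rewrite /conj_diag !mulmxA WW.
    by rewrite mul1mx -!mulmxA VV mulmx1 !mulmxA.
  have := congr1 (fun M => W *m M *m V^t*) E; rewrite /conj_diag !mulmxA WW'.
  by rewrite mul1mx -!mulmxA VV' mulmx1 !mulmxA.
have /QlQ Q1 : conj_diag V (id \o l) = conj_diag W (id \o m) by [].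
apply/QlQ; apply/matrixP => i j; move/matrixP/(_ i j): Q1.
rewrite !mul_mx_diag !mul_diag_mx; set Q := W^t* *m V => QE.
move: QE; rewrite !mxE /= mulrC => /eqP.
rewrite -subr_eq0 -mulrBl mulf_eq0 => /orP[|/eqP ->]; last by rewrite mulr0 mul0r.
by rewrite subr_eq0 => /eqP /complexI ->; rewrite mulrC.
Qed.

(** Passing to the orthonormal basis [V] turns both commutators into entrywise
    multiples of one matrix [V^* B V], and the Frobenius norm is unchanged. *)
Lemma frob2_commutator_le V B (a x p q : 'I_n -> R) (K : R) :
    V^t* *m V = 1%:M ->
    (forall i j, (x i - x j) ^+ 2 <= K * (p i * (a i - a j) * q j) ^+ 2) ->
  frob2 (conj_diag V x *m B - B *m conj_diag V x) <=
    K * frob2 (conj_diag V p *m (conj_diag V a *m B - B *m conj_diag V a)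
               *m conj_diag V q).
Proof.
move=> VV le_xp; have VV' : V *m V^t* = 1%:M by exact: mulmx1C.
have [C BE] : exists C, B = V *m C *m V^t*.
  exists (V^t* *m B *m V).
  by rewrite !mulmxA VV' mul1mx -mulmxA VV' mulmx1.
have commE l : conj_diag V l *m B - B *m conj_diag V l =
    V *m (rdiag l *m C - C *m rdiag l) *m V^t*.
  rewrite BE /conj_diag mulmxBr mulmxBl !mulmxA.
  rewrite -[V *m rdiag l *m V^t* *m V]mulmxA VV mulmx1.
  by rewrite -[V *m C *m V^t* *m V]mulmxA VV mulmx1.
rewrite !commE.
have -> : conj_diag V p *m (V *m (rdiag a *m C - C *m rdiag a) *m V^t*)
    *m conj_diag V q =
    V *m (rdiag p *m (rdiag a *m C - C *m rdiag a) *m rdiag q) *m V^t*.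
  rewrite /conj_diag !mulmxA -[V *m rdiag p *m V^t* *m V]mulmxA VV mulmx1.
  set Z := (_ - _); rewrite -[V *m rdiag p *m Z *m V^t* *m V]mulmxA VV mulmx1.
  by [].
rewrite !frob2_unitary // /frob2 mulr_sumr ler_sum // => i _.
rewrite mulr_sumr ler_sum // => j _.
have entry l : (rdiag l *m C - C *m rdiag l) i j = (l i - l j)%:C%C * C i j.
  by rewrite mul_diag_mx mul_mx_diag !mxE rmorphB mulrBl [C i j * _]mulrC.
have outer (W : 'M[R[i]]_n) : (rdiag p *m W *m rdiag q) i j =
    (p i)%:C%C * W i j * (q j)%:C%C.
  by rewrite mul_mx_diag mxE mul_diag_mx !mxE.
rewrite outer !entry !sqmodM !sqmod_real.
have := ler_wpM2r (sqmod_ge0 (C i j)) (le_xp i j).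
move=> /le_trans; apply; rewrite le_eqVlt; apply/orP; left; apply/eqP; ring.
Qed.

End Unitary.

(** * Tensors as matrices and their spectra *)

Section TensorMatrix.
Local Open Scope sesquilinear_scope.
Variables (R : realType) (N : nat) (I : 'I_N -> nat).
Local Notation n := (dimprod I).
Implicit Types X Y : tensor R I I.

Lemma card_midx : #|midx I| = n.
Proof.
rewrite card_dep_ffun foldrE big_map big_enum /dimprod.
by apply: eq_bigr => k _; rewrite card_ord.
Qed.

(** A numbering of the multi-indices turns square tensors into matrices, with
    the Einstein product as matrix product, so that the spectral theorem for
    matrices applies. *)
Definition midx_of (k : 'I_n) : midx I := enum_val (cast_ord (esym card_midx) k).
Definition rank_of (a : midx I) : 'I_n := cast_ord card_midx (enum_rank a).

Lemma midx_ofK : cancel midx_of rank_of.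
Proof. by move=> k; rewrite /rank_of /midx_of enum_valK cast_ordKV. Qed.

Lemma rank_ofK : cancel rank_of midx_of.
Proof. by move=> a; rewrite /rank_of /midx_of cast_ordK enum_rankK. Qed.

Definition mxof X : 'M[R[i]]_n := \matrix_(i, j) X (midx_of i, midx_of j).
Definition tensor_of (M : 'M[R[i]]_n) : tensor R I I :=
  [ffun ab => M (rank_of ab.1) (rank_of ab.2)].

Lemma mxofK : cancel mxof tensor_of.
Proof. by move=> X; apply/ffunP => -[a b]; rewrite ffunE mxE !rank_ofK. Qed.

Lemma mxof_inj : injective mxof. Proof. exact: can_inj mxofK. Qed.

Lemma sum_midx (T : nmodType) (F : midx I -> T) :
  \sum_a F a = \sum_k F (midx_of k).
Proof. by rewrite (reindex midx_of) //; exists rank_of => ? _;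
  rewrite ?midx_ofK ?rank_ofK. Qed.

Lemma mxofM X Y : mxof (X ⋆ Y) = mxof X *m mxof Y.
Proof.
apply/matrixP => i j; rewrite !mxE ffunE /= sum_midx.
by apply: eq_bigr => k _; rewrite !mxE.
Qed.

Lemma mxofB X Y : mxof (X - Y) = mxof X - mxof Y.
Proof. by apply/matrixP => i j; rewrite !mxE !ffunE. Qed.

Lemma mxof_ctransp X : mxof (ctransp X) = (mxof X)^t*.
Proof. by apply/matrixP => i j; rewrite !mxE !ffunE. Qed.

Lemma mxof_commutator X Y :
  mxof (commutator X Y) = mxof X *m mxof Y - mxof Y *m mxof X.
Proof. by rewrite mxofB !mxofM. Qed.

Lemma card_unit_midx : #|midx unit_shape| = 1%N.
Proof. by rewrite card_dep_ffun foldrE big_map big_enum big_ord1 card_ord. Qed.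

Definition unit_midx : midx unit_shape :=
  enum_val (cast_ord (esym card_unit_midx) ord0).

Lemma unit_midx_uniq (u : midx unit_shape) : u = unit_midx.
Proof.
have /eqP/fintype1P[x xE] := card_unit_midx.
by rewrite (xE u) (xE unit_midx).
Qed.

Lemma sum_unit_midx (T : nmodType) (F : midx unit_shape -> T) :
  \sum_u F u = F unit_midx.
Proof.
rewrite (bigD1 unit_midx) //= big1 ?addr0 // => u.
by rewrite (unit_midx_uniq u) eqxx.
Qed.

Local Notation eigendata :=
  ({ffun 'I_n -> R} * {ffun 'I_n -> tensor R I unit_shape})%type.

(** The matrix whose columns are the eigenvectors. *)
Definition eigenmx (lU : eigendata) : 'M[R[i]]_n :=
  \matrix_(a, k) lU.2 k (midx_of a, unit_midx).

Lemma mxof_spectral_sum f (lU : eigendata) :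
  mxof (spectral_sum f lU) = conj_diag (eigenmx lU) (f \o lU.1).
Proof.
apply/matrixP => a b; rewrite /conj_diag mul_mx_diag !mxE sum_ffunE.
apply: eq_bigr => k _; rewrite !ffunE /= sum_unit_midx ffunE !mxE /=.
by rewrite /GRing.scale /= mulrA [_%:C%C * _]mulrC.
Qed.

Lemma eigendecompositionE (H : tensor R I I) (lU : eigendata) :
  is_eigendecomposition H lU <->
  (eigenmx lU)^t* *m eigenmx lU = 1%:M /\
  mxof H = conj_diag (eigenmx lU) lU.1.
Proof.
have -> : conj_diag (eigenmx lU) lU.1 = mxof (spectral_sum id lU).
  by rewrite mxof_spectral_sum.
split=> -[orth HE]; split; try by [rewrite HE|apply: mxof_inj].
  apply/matrixP => i j; have /ffunP/(_ (unit_midx, unit_midx)) := orth i j.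
  rewrite !ffunE !mxE => <- /=; rewrite sum_midx; apply: eq_bigr => k _.
  by rewrite !mxE ffunE.
move=> i j; apply/ffunP => -[u v]; rewrite !ffunE /=.
rewrite (unit_midx_uniq u) (unit_midx_uniq v).
have /matrixP/(_ i j) := orth; rewrite !mxE => <-; rewrite sum_midx.
by apply: eq_bigr => k _; rewrite !mxE ffunE.
Qed.

Lemma hermitian_has_eigendecomposition (H : tensor R I I) :
  hermitian_tensor H -> exists lU, is_eigendecomposition H lU.
Proof.
move=> hH; have hM : mxof H \is hermsymmx.
  by rewrite is_hermitianmxE expr0 scale1r -mxof_ctransp hH.
have /orthomx_spectralP := hermitian_normalmx hM.
have /mxOverP Dr := hermitian_spectral_diag_real hM.
have := spectral_unitarymx (mxof H).
set P := spectralmx _; set D := spectral_diag _ => uP.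
rewrite invmx_unitary // => HE.
pose lU : eigendata := ([ffun k => complex.Re (D 0 k)],
  [ffun k => [ffun ab => (P k (rank_of ab.1))^*]]).
have VE : eigenmx lU = P^t*.
  by apply/matrixP => a k; rewrite !mxE !ffunE midx_ofK.
exists lU; apply/eigendecompositionE; rewrite VE trmxCK.
split; first exact/unitarymxP.
rewrite /conj_diag trmxCK HE; congr (_ *m diag_mx _ *m _).
by apply/rowP => k; rewrite mxE ffunE RRe_real.
Qed.

Lemma eigendecompositionP (H : tensor R I I) : hermitian_tensor H ->
  is_eigendecomposition H (eigendecomposition H).
Proof. by move=> /hermitian_has_eigendecomposition[lU]; exact: xgetI. Qed.

Definition eigenbasis (H : tensor R I I) := eigenmx (eigendecomposition H).
Local Notation eigenval := (@eigenvalue_tensor R N I).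

Lemma eigenbasis_unitary H : hermitian_tensor H ->
  (eigenbasis H)^t* *m eigenbasis H = 1%:M.
Proof. by move=> /eigendecompositionP/eigendecompositionE[]. Qed.

Lemma mxof_eigen H : hermitian_tensor H ->
  mxof H = conj_diag (eigenbasis H) (eigenval H).
Proof. by move=> /eigendecompositionP/eigendecompositionE[]. Qed.

Lemma mxof_tpow H p :
  mxof (tpow H p) = conj_diag (eigenbasis H) (fun k => eigenval H k `^ p).
Proof. exact: mxof_spectral_sum. Qed.

Lemma gram_hermitian X : hermitian_tensor (ctransp X ⋆ X).
Proof.
apply: mxof_inj.
by rewrite !(mxof_ctransp, mxofM) trmx_mul map_mxM trmxCK.
Qed.

(** In the eigenbasis, an eigenvalue of [X^H X] is the squared length of a column
    of [X V]. *)
Lemma gram_eigenvalue_ge0 X k : 0 <= eigenval (ctransp X ⋆ X) k.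
Proof.
have hG := gram_hermitian X.
set V := eigenbasis (ctransp X ⋆ X).
have VV : V^t* *m V = 1%:M by exact: eigenbasis_unitary.
have E : (mxof X *m V)^t* *m (mxof X *m V) = rdiag (eigenval (ctransp X ⋆ X)).
  have := mxof_eigen hG; rewrite mxofM mxof_ctransp -/V => GE.
  rewrite trmx_mul map_mxM mulmxA -(mulmxA (V^t*)) GE /conj_diag !mulmxA VV.
  by rewrite mul1mx -mulmxA VV mulmx1.
move: (mxof X *m V) E => W /matrixP/(_ k k); rewrite !mxE eqxx mulr1n => E.
suff -> : eigenval (ctransp X ⋆ X) k = \sum_j sqmod (W j k).
  by apply: sumr_ge0 => j _; exact: sqmod_ge0.
apply: complexI; rewrite -E raddf_sum; apply: eq_bigr => j _ /=.
by rewrite sqmodE !mxE.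
Qed.

(** Squaring the eigenvalues of [A] gives one eigen-decomposition of [A^H A]; the
    one chosen by [tabs] may differ, but yields the same square root. *)
Lemma tabs_posdef (A : tensor R I I) : posdef A -> tabs A = A.
Proof.
move=> [hA A_gt0]; apply: mxof_inj; rewrite /tabs /tsqrt mxof_spectral_sum.
have hG := gram_hermitian A.
have VV := eigenbasis_unitary hA; have AE := mxof_eigen hA.
rewrite AE -(@conj_diag_uniq _ _ (eigenbasis A) _
  (fun k => eigenval A k * eigenval A k) _ Num.sqrt) //.
- congr (conj_diag _ _); apply/funext => k /=.
  by rewrite -expr2 sqrtr_sqr ger0_norm // ltW.
- exact: eigenbasis_unitary.
- by rewrite -mxof_eigen // mxofM mxof_ctransp AE conj_diag_ctransp conj_diagM.
Qed.

Lemma frob2_eigen X : frob2 (mxof X) = \sum_k eigenval (ctransp X ⋆ X) k.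
Proof.
apply: complexI; rewrite frob2_trace -mxof_ctransp -mxofM.
have hG := gram_hermitian X.
by rewrite mxof_eigen // conj_diag_trace //; exact: eigenbasis_unitary.
Qed.

Lemma spectral_norm_ge0 X : 0 <= spectral_norm X.
Proof.
rewrite /spectral_norm; elim/big_ind: _ => // [x y x0 y0|k _].
  by rewrite le_max x0.
exact: sqrtr_ge0.
Qed.

Lemma singular_value_sqr X k :
  singular_value X k ^+ 2 = eigenval (ctransp X ⋆ X) k.
Proof. by rewrite sqr_sqrtr // gram_eigenvalue_ge0. Qed.

Lemma spectral_norm_le_frob X : spectral_norm X ^+ 2 <= frob2 (mxof X).
Proof.
rewrite -[leRHS]sqr_sqrtr ?frob2_ge0 // ler_pXn2r ?nnegrE ?sqrtr_ge0 //;
  last exact: spectral_norm_ge0.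
apply/bigmax_leP; split=> [|k _]; first exact: sqrtr_ge0.
rewrite ler_sqrt ?frob2_ge0 // frob2_eigen (bigD1 k) //= lerDl.
by apply: sumr_ge0 => j _; exact: gram_eigenvalue_ge0.
Qed.

Lemma frob_le_spectral_norm X :
  frob2 (mxof X) <= n%:R * spectral_norm X ^+ 2.
Proof.
rewrite frob2_eigen -[n in leRHS]card_ord mulr_natl -sumr_const ler_sum // => k _.
rewrite -singular_value_sqr ler_pXn2r ?nnegrE ?sqrtr_ge0 //;
  last exact: spectral_norm_ge0.
by rewrite /spectral_norm; exact: le_bigmax.
Qed.

(** The two commutators are entrywise proportional in an
    eigenbasis of [A], and the Frobenius norm is at most the square root of the
    dimension times the spectral norm. *)
Lemma commutator_spectral_norm_le (A B : tensor R I I) (nu s t G : R) :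
    posdef A -> 0 <= G ->
    (forall x y, 0 < x -> 0 < y -> `|x * x `^ (- nu) - y * y `^ (- nu)| <=
       G * `|x `^ (- s) * (x - y) * y `^ (- t)|) ->
  spectral_norm (commutator (A ⋆ tpow (tabs A) (- nu)) B) <=
    Num.sqrt n%:R * G *
    spectral_norm (tpow (tabs A) (- s) ⋆ commutator A B ⋆ tpow (tabs A) (- t)).
Proof.
move=> pA G_ge0 hG; rewrite (tabs_posdef pA); have [hA A_gt0] := pA.
set Y := commutator _ _; set Z := _ ⋆ _ ⋆ _.
have VV := eigenbasis_unitary hA.
have le_frob : frob2 (mxof Y) <= G ^+ 2 * frob2 (mxof Z).
  rewrite /Y /Z !(mxofM, mxof_commutator) !mxof_tpow (mxof_eigen hA).
  rewrite conj_diagM //; apply: frob2_commutator_le => // i j.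
  rewrite -exprMn -[leLHS]real_normK ?num_real // -[leRHS]real_normK ?num_real //.
  by rewrite ler_pXn2r ?nnegrE // normrM (ger0_norm G_ge0) hG.
rewrite -(@ler_pXn2r _ 2) ?nnegrE ?mulr_ge0 ?sqrtr_ge0 ?spectral_norm_ge0 //.
rewrite !exprMn sqr_sqrtr ?ler0n //.
apply: (le_trans (spectral_norm_le_frob Y)); apply: (le_trans le_frob).
rewrite [leRHS](_ : _ = G ^+ 2 * (n%:R * spectral_norm Z ^+ 2)); last by ring.
by apply: ler_wpM2l; [exact: sqr_ge0|exact: frob_le_spectral_norm].
Qed.

End TensorMatrix.

(** * Measurability of random tensors *)

Section ComplexParts.
Variable R : realType.
Implicit Types x y : R[i].

Lemma ReD x y : complex.Re (x + y) = complex.Re x + complex.Re y.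
Proof. by case: x y => [? ?] []. Qed.

Lemma ImD x y : complex.Im (x + y) = complex.Im x + complex.Im y.
Proof. by case: x y => [? ?] []. Qed.

Lemma ReB x y : complex.Re (x - y) = complex.Re x - complex.Re y.
Proof. by case: x y => [? ?] []. Qed.

Lemma ImB x y : complex.Im (x - y) = complex.Im x - complex.Im y.
Proof. by case: x y => [? ?] []. Qed.

Lemma ReM x y : complex.Re (x * y) =
  complex.Re x * complex.Re y - complex.Im x * complex.Im y.
Proof. by case: x y => [? ?] []. Qed.

Lemma ImM x y : complex.Im (x * y) =
  complex.Re x * complex.Im y + complex.Im x * complex.Re y.
Proof. by case: x y => [? ?] []. Qed.

Lemma Re_conj x : complex.Re x^* = complex.Re x.
Proof. by case: x. Qed.

Lemma Im_conj x : complex.Im x^* = - complex.Im x.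
Proof. by case: x. Qed.

Lemma Re_sum (J : Type) (r : seq J) (F : J -> R[i]) :
  complex.Re (\sum_(j <- r) F j) = \sum_(j <- r) complex.Re (F j).
Proof. exact: (big_morph (@complex.Re R) ReD). Qed.

Lemma Im_sum (J : Type) (r : seq J) (F : J -> R[i]) :
  complex.Im (\sum_(j <- r) F j) = \sum_(j <- r) complex.Im (F j).
Proof. exact: (big_morph (@complex.Im R) ImD). Qed.

End ComplexParts.

Section RandomTensor.
Context d (Omega : measurableType d) (R : realType).
Variables (N : nat) (I : 'I_N -> nat).
Local Notation n := (dimprod I).
Implicit Types A B : Omega -> tensor R I I.

Lemma random_einstein A B : random_tensor A -> random_tensor B ->
  random_tensor (fun w => A w ⋆ B w).
Proof.
move=> mA mB [i k]; split.
  apply: (eq_measurable_fun (fun w => \sum_j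
    (complex.Re (A w (i, j)) * complex.Re (B w (j, k))
     - complex.Im (A w (i, j)) * complex.Im (B w (j, k))))) => [w _|].
    by rewrite ffunE Re_sum; apply: eq_bigr => j _; rewrite ReM.
  apply: measurable_sum => j; have [? ?] := mA (i, j); have [? ?] := mB (j, k).
  by apply: measurable_funB; exact: measurable_funM.
apply: (eq_measurable_fun (fun w => \sum_j
  (complex.Re (A w (i, j)) * complex.Im (B w (j, k))
   + complex.Im (A w (i, j)) * complex.Re (B w (j, k))))) => [w _|].
  by rewrite ffunE Im_sum; apply: eq_bigr => j _; rewrite ImM.
apply: measurable_sum => j; have [? ?] := mA (i, j); have [? ?] := mB (j, k).
by apply: measurable_funD; exact: measurable_funM.
Qed.

Lemma random_tensorD A B : random_tensor A -> random_tensor B ->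
  random_tensor (fun w => A w + B w).
Proof.
move=> mA mB ij; have [? ?] := mA ij; have [? ?] := mB ij; split.
  apply: (eq_measurable_fun (fun w =>
    complex.Re (A w ij) + complex.Re (B w ij))) => [w _|].
    by rewrite ffunE ReD.
  exact: measurable_funD.
apply: (eq_measurable_fun (fun w =>
  complex.Im (A w ij) + complex.Im (B w ij))) => [w _|].
  by rewrite ffunE ImD.
exact: measurable_funD.
Qed.

Lemma random_tensorB A B : random_tensor A -> random_tensor B ->
  random_tensor (fun w => A w - B w).
Proof.
move=> mA mB ij; have [? ?] := mA ij; have [? ?] := mB ij; split.
  apply: (eq_measurable_fun (fun w =>
    complex.Re (A w ij) - complex.Re (B w ij))) => [w _|].
    by rewrite !ffunE ReB.
  exact: measurable_funB.
apply: (eq_measurable_fun (fun w =>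
  complex.Im (A w ij) - complex.Im (B w ij))) => [w _|].
  by rewrite !ffunE ImB.
exact: measurable_funB.
Qed.

Lemma random_commutator A B : random_tensor A -> random_tensor B ->
  random_tensor (fun w => commutator (A w) (B w)).
Proof. by move=> mA mB; apply: random_tensorB; exact: random_einstein. Qed.

Lemma random_ctransp A : random_tensor A ->
  random_tensor (fun w => ctransp (A w)).
Proof.
move=> mA [i j]; have [mRe mIm] := mA (j, i); split.
  by apply: eq_measurable_fun mRe => w _; rewrite ffunE Re_conj.
apply: (eq_measurable_fun (fun w => - complex.Im (A w (j, i)))) => [w _|].
  by rewrite ffunE Im_conj.
exact: measurable_funN.
Qed.

Lemma random_scale (c : R[i]) A : random_tensor A ->
  random_tensor (fun w => c *: A w).
Proof.
move=> mA ij; have [? ?] := mA ij; split.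
  apply: (eq_measurable_fun (fun w => complex.Re c * complex.Re (A w ij)
    - complex.Im c * complex.Im (A w ij))) => [w _|].
    by rewrite ffunE ReM.
  by apply: measurable_funB; apply: measurable_funM => //; exact: measurable_cst.
apply: (eq_measurable_fun (fun w => complex.Re c * complex.Im (A w ij)
  + complex.Im c * complex.Re (A w ij))) => [w _|].
  by rewrite ffunE ImM.
by apply: measurable_funD; apply: measurable_funM => //; exact: measurable_cst.
Qed.

End RandomTensor.

(** * Borel functional calculus of a random Hermitian tensor *)

Section BorelCalculus.
Import HBNNSimple.
Context d (Omega : measurableType d) (R : realType).
Variables (N : nat) (I : 'I_N -> nat) (H : Omega -> tensor R I I).
Local Notation n := (dimprod I).
Hypotheses (H_random : random_tensor H)
  (H_hermitian : forall w, hermitian_tensor (H w)).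

Definition fun_calc (f : R -> R) (w : Omega) : tensor R I I :=
  spectral_sum f (eigendecomposition (H w)).

(* Not automatic: the eigen-decompositions are chosen separately for each
   outcome. *)
Local Notation calculable f := (random_tensor (fun_calc f)).

Lemma fun_calcM f h w :
  fun_calc (fun x => f x * h x) w = fun_calc f w ⋆ fun_calc h w.
Proof.
apply: mxof_inj; rewrite mxofM !mxof_spectral_sum conj_diagM //.
exact: eigenbasis_unitary.
Qed.

Lemma fun_calcE f w ij : fun_calc f w ij = \sum_(k < n)
  (f ((eigendecomposition (H w)).1 k))%:C%C *
  ((eigendecomposition (H w)).2 k ⋆ ctransp ((eigendecomposition (H w)).2 k)) ij.
Proof.
rewrite /fun_calc /spectral_sum sum_ffunE.
by apply: eq_bigr => k _; rewrite ffunE.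
Qed.

Lemma fun_calcD f h w :
  fun_calc (fun x => f x + h x) w = fun_calc f w + fun_calc h w.
Proof.
apply/ffunP => ij; rewrite ffunE !fun_calcE -big_split /=.
by apply: eq_bigr => k _; rewrite rmorphD mulrDl.
Qed.

Lemma fun_calcZ c f w : fun_calc (fun x => c * f x) w = c%:C%C *: fun_calc f w.
Proof.
apply/ffunP => ij; rewrite ffunE !fun_calcE scaler_sumr.
by apply: eq_bigr => k _; rewrite rmorphM -mulrA.
Qed.

(** Completeness: orthonormal eigenvectors in full number resolve the identity. *)
Lemma fun_calc1 w : fun_calc (fun=> 1) w = tensor_of 1%:M.
Proof.
apply: (can_inj (@mxofK R N I)); rewrite mxof_spectral_sum.
have -> : mxof (tensor_of 1%:M : tensor R I I) = 1%:M.
  by apply/matrixP => i j; rewrite !mxE ffunE !midx_ofK mxE.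
rewrite /conj_diag (_ : rdiag _ = 1%:M).
  by rewrite mulmx1; apply: mulmx1C; exact: eigenbasis_unitary.
by rewrite /rdiag -diag_const_mx; congr diag_mx; apply/rowP => k; rewrite !mxE.
Qed.

Lemma calculableM f h : calculable f -> calculable h ->
  calculable (fun x => f x * h x).
Proof.
move=> cf ch; have -> : fun_calc (fun x => f x * h x) =
  (fun w => fun_calc f w ⋆ fun_calc h w) by apply/funext => w; rewrite fun_calcM.
exact: random_einstein.
Qed.

Lemma calculableD f h : calculable f -> calculable h ->
  calculable (fun x => f x + h x).
Proof.
move=> cf ch; have -> : fun_calc (fun x => f x + h x) =
  (fun w => fun_calc f w + fun_calc h w) by apply/funext => w; rewrite fun_calcD.
exact: random_tensorD.
Qed.

Lemma calculableZ c f : calculable f -> calculable (fun x => c * f x).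
Proof.
move=> cf; have -> : fun_calc (fun x => c * f x) =
  (fun w => c%:C%C *: fun_calc f w) by apply/funext => w; rewrite fun_calcZ.
exact: random_scale.
Qed.

Lemma calculable_cst c : calculable (fun=> c).
Proof.
rewrite (_ : (fun=> c) = (fun x => c * (fun=> 1) x)); last first.
  by apply/funext => x; rewrite mulr1.
apply: calculableZ; have -> : fun_calc (fun=> 1) = fun=> tensor_of 1%:M.
  by apply/funext => w; exact: fun_calc1.
by move=> ij; split; exact: measurable_cst.
Qed.

Lemma calculable_id : calculable id.
Proof.
suff -> : fun_calc id = H by [].
by apply/funext => w; have [_ /esym] := eigendecompositionP (H_hermitian w).
Qed.

Lemma calculableB f h : calculable f -> calculable h ->
  calculable (fun x => f x - h x).
Proof.
move=> cf ch; rewrite (_ : (fun x => f x - h x) = fun x => f x + -1 * h x).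
  by apply: calculableD => //; exact: calculableZ.
by apply/funext => x; rewrite mulN1r.
Qed.

Lemma calculableX f k : calculable f -> calculable (fun x => f x ^+ k).
Proof.
move=> cf; elim: k => [|k IH]; first exact: calculable_cst.
rewrite (_ : (fun x => f x ^+ k.+1) = fun x => f x * f x ^+ k).
  exact: calculableM.
by apply/funext => x; rewrite exprS.
Qed.

Lemma calculable_sum (J : Type) (r : seq J) (f : J -> R -> R) :
  (forall j, calculable (f j)) -> calculable (fun x => \sum_(j <- r) f j x).
Proof.
move=> cf; elim: r => [|j r IH].
  rewrite (_ : (fun x => _) = fun=> 0); first exact: calculable_cst.
  by apply/funext => x; rewrite big_nil.
rewrite (_ : (fun x => _) = fun x => f j x + \sum_(i <- r) f i x).
  exact: calculableD.
by apply/funext => x; rewrite big_cons.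
Qed.

Lemma calculable_prod (f : nat -> R -> R) k :
  (forall j, calculable (f j)) -> calculable (fun x => \prod_(j < k) f j x).
Proof.
move=> cf; elim: k => [|k IH].
  rewrite (_ : (fun x => _) = fun=> 1); first exact: calculable_cst.
  by apply/funext => x; rewrite big_ord0.
rewrite (_ : (fun x => _) = fun x => (\prod_(j < k) f j x) * f k x).
  exact: calculableM.
by apply/funext => x; rewrite big_ord_recr.
Qed.

(** For each outcome only finitely many eigenvalues matter, so pointwise
    convergence of the functions is enough, with no uniformity. *)
Lemma calculable_cvg (f_ : nat -> R -> R) f : (forall m, calculable (f_ m)) ->
  (forall x, f_ m x @[m --> \oo] --> f x) -> calculable f.
Proof.
move=> cf f_f ij; split.
  apply: (@measurable_fun_cvg _ _ _ _
    (fun m w => complex.Re (fun_calc (f_ m) w ij))) => [m|w _].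
    by have [] := cf m ij.
  rewrite fun_calcE Re_sum; under eq_fun do rewrite fun_calcE Re_sum.
  apply: cvg_big => [|k _]; first exact: add_continuous.
  under eq_fun do rewrite ReM /= mul0r subr0.
  by rewrite ReM /= mul0r subr0; apply: cvgMl; exact: f_f.
apply: (@measurable_fun_cvg _ _ _ _
  (fun m w => complex.Im (fun_calc (f_ m) w ij))) => [m|w _].
  by have [] := cf m ij.
rewrite fun_calcE Im_sum; under eq_fun do rewrite fun_calcE Im_sum.
apply: cvg_big => [|k _]; first exact: add_continuous.
under eq_fun do rewrite ImM /= mul0r addr0.
by rewrite ImM /= mul0r addr0; apply: cvgMl; exact: f_f.
Qed.

Lemma calculable_expR f : calculable f -> calculable (fun x => expR (f x)).
Proof.
move=> cf; apply: (@calculable_cvg (fun m x => series (exp_coeff (f x)) m)).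
  move=> m; rewrite (_ : (fun x => _) =
      fun x => \sum_(k <- index_iota 0 m) k`!%:R^-1 * f x ^+ k).
    by apply: calculable_sum => k; apply: calculableZ; exact: calculableX.
  by apply/funext => x; rewrite /series /= exp_coeffE.
by move=> x; exact: is_cvg_series_exp_coeff.
Qed.

(** As [m] grows, [expR (- expR (- m * y))] tends to [1] for [y > 0], to
    [expR (- 1) < 1] for [y = 0] and to [0] for [y < 0]; high powers of the limit
    then tend to the indicator of [y > 0]. *)
Lemma calculable_pos f : calculable f -> calculable (fun x => (0 < f x)%R%:R).
Proof.
move=> cf.
pose s (y : R) : R := if 0 < y then 1 else if y == 0 then expR (- 1) else 0.
have cs : calculable (fun x => s (f x)).
  apply: (@calculable_cvg (fun m x => expR (-1 * expR (-1 * f x) ^+ m))).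
    by move=> m; apply: calculable_expR; apply: calculableZ; apply: calculableX;
      apply: calculable_expR; exact: calculableZ.
  move=> x; rewrite /s; under eq_fun do rewrite !mulN1r.
  case: ltgtP => [fx_gt0|fx_lt0|<-].
  - suff : expR (- expR (- f x) ^+ m) @[m --> \oo] --> expR (- (0 : R)).
      by rewrite oppr0 expR0.
    apply: continuous_cvg; first exact: continuous_expR.
    apply: cvgN; apply: cvg_expr.
    by rewrite ger0_norm ?expR_ge0// expR_lt1 oppr_lt0.
  - apply: (@squeeze_cvgr _ _ _ _ (fun=> 0) (fun m => expR (f x) ^+ m)).
    + near=> m; rewrite expR_ge0 /= -!expRM_natl ler_expR lerNl -mulrN.
      by apply: le_trans (expR_ge1Dx _); rewrite lerDr.
    + exact: cvg_cst.
    + by apply: cvg_expr; rewrite ger0_norm ?expR_ge0// expR_lt1.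
  - under eq_fun do rewrite oppr0 expR0 expr1n.
    exact: cvg_cst.
apply: (@calculable_cvg (fun m x => s (f x) ^+ m)) => [m|x].
  exact: calculableX.
rewrite /s; case: ltgtP => _ /=.
- by under eq_fun do rewrite expr1n; exact: cvg_cst.
- by apply: cvg_expr; rewrite normr0.
- by apply: cvg_expr; rewrite ger0_norm ?expR_ge0// expR_lt1 oppr_lt0.
Unshelve. all: by end_near.
Qed.

(** The sets whose indicator qualifies form a sigma-algebra that contains the open
    rays. *)
Lemma calculable_indic (S : set R) : measurable S -> calculable (\1_S).
Proof.
rewrite [X in X S -> _]RGenOInfty.measurableE.
apply: (@smallest_sub _ (sigma_algebra setT) _ (fun S => calculable (\1_S))).
- split=> [|A cA|A cA].
  + rewrite (_ : \1_set0 = fun=> 0); first exact: calculable_cst.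
    by apply/funext => x; rewrite indicE in_set0.
  + rewrite (_ : \1_(setT `\` A) = fun x => 1 - \1_A x).
      by apply: calculableB => //; exact: calculable_cst.
    apply/funext => x; rewrite !indicE setTD in_setC.
    by case: (x \in A); rewrite (subrr, subr0).
  (* outside the union, every factor [1 - \1_(A j)] is [1]; inside, one is
     [0] from some rank on *)
  + apply: (@calculable_cvg (fun m x => 1 - \prod_(j < m) (1 - \1_(A j) x))).
      move=> m; apply: calculableB; first exact: calculable_cst.
      apply: (@calculable_prod (fun j x => 1 - \1_(A j) x)) => j.
      by apply: calculableB => //; exact: calculable_cst.
    move=> x; rewrite indicE; have [|] := boolP (x \in _); last first.
      move/negP => nAx; rewrite (_ : (fun m => _) = fun=> 0);
        first exact: cvg_cst.
      apply/funext => m; rewrite big1 ?subrr // => j _.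
      rewrite indicE memNset ?subr0 // => Ax; apply: nAx.
      by rewrite inE; exists j.
    rewrite inE => -[j _ Ax]; apply: cvg_near_cst.
    exists j.+1 => // m /= jm; rewrite (bigD1 (Ordinal jm)) //=.
    by rewrite indicE mem_set // subrr mul0r subr0.
- move=> _ [a ->].
  rewrite (_ : \1_ _ = fun x => (0 < x - a)%R%:R).
    by apply: calculable_pos; apply: calculableB;
      [exact: calculable_id|exact: calculable_cst].
  by apply/funext => x; rewrite indicE mem_setE in_itv /= andbT subr_gt0.
Qed.

(** A nonnegative Borel function is a pointwise limit of simple functions, that
    is of linear combinations of indicators. *)
Lemma calculable_ge0 (f : R -> R) : (forall x, 0 <= f x) ->
  measurable_fun setT f -> calculable f.
Proof.
move=> f_ge0 /measurable_EFinP mf.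
pose f_ m : R -> R := nnsfun_approx measurableT mf m.
apply: (@calculable_cvg f_) => [m|x]; last first.
  apply: (@fine_cvg _ _ _ _ (fun m => (f_ m x)%:E)).
  by apply: (cvg_nnsfun_approx measurableT mf) => // y _; rewrite lee_fin.
rewrite /f_; set h := nnsfun_approx _ _ _.
rewrite (_ : (h : R -> R) =
    fun x => \sum_(y <- finmap.enum_fset (fset_set (range h)))
      y * \1_(h @^-1` [set y]) x).
  apply: calculable_sum => y; apply: calculableZ; apply: calculable_indic.
  exact: measurable_funPTI.
by apply/funext => x; rewrite fimfunE fsbig_finite.
Qed.

End BorelCalculus.

Section RandomSpectrum.
Context d (Omega : measurableType d) (R : realType).
Variables (N : nat) (I : 'I_N -> nat).
Implicit Types A B : Omega -> tensor R I I.

Lemma random_tpow A p : random_tensor A ->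
  (forall w, hermitian_tensor (A w)) ->
  random_tensor (fun w => tpow (A w) p).
Proof.
move=> mA hA; apply: (calculable_ge0 mA hA) => [x|]; first exact: powR_ge0.
exact: measurable_powR.
Qed.

(** An eigenvalue of the Gram tensor reaches a level exactly when the spectral
    projection above that level, a random tensor, has positive trace. *)
Lemma measurable_spectral_norm A : random_tensor A ->
  measurable_fun setT (fun w => spectral_norm (A w)).
Proof.
move=> mA; have mG := random_einstein (random_ctransp mA) mA.
have hG w := gram_hermitian (A w).
apply: (measurability (@RGenCInfty.G R)) => [|/= _ [_] [r] -> <-].
  exact: RGenCInfty.measurableE.
rewrite setTI; have [r_le0|r_gt0] := leP r 0.
  rewrite (_ : _ @^-1` _ = setT) //; apply/seteqP; split => w //= _.
  by rewrite in_itv /= andbT (le_trans r_le0) ?spectral_norm_ge0.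
(* [tr w] counts the eigenvalues that reach [r ^+ 2] *)
pose tr w := complex.Re (\tr (mxof (fun_calc (fun w => ctransp (A w) ⋆ A w)
  (\1_`[r ^+ 2, +oo[%classic) w))).
have trE w : tr w = \sum_k
    \1_`[r ^+ 2, +oo[%classic (eigenvalue_tensor (ctransp (A w) ⋆ A w) k).
  rewrite /tr mxof_spectral_sum conj_diag_trace //.
  exact: eigenbasis_unitary.
have mtr : measurable_fun setT tr.
  apply: (eq_measurable_fun (fun w => \sum_k complex.Re
    (fun_calc (fun w => ctransp (A w) ⋆ A w) (\1_`[r ^+ 2, +oo[%classic) w
      (midx_of k, midx_of k)))) => [w _|].
    by rewrite /tr /mxtrace Re_sum; apply: eq_bigr => k _; rewrite mxE.
  apply: measurable_sum => k.
  have cI := @calculable_indic _ _ _ _ _ _ mG hG `[r ^+ 2, +oo[%classic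
    (measurable_itv _).
  by have [] := cI (midx_of k, midx_of k).
rewrite (_ : _ @^-1` _ = tr @^-1` `]0, +oo[%classic).
  by rewrite -[X in measurable X]setTI; apply: mtr => //; exact: measurable_itv.
apply/seteqP; split => w /=; rewrite !in_itv /= !andbT trE; last first.
  apply: contraTT; rewrite -ltNge => /bigmax_ltP[_ lt_r].
  rewrite -leNgt big1 // => k _; rewrite indicE memNset //=.
  rewrite in_itv /= andbT; apply/negP; rewrite -ltNge.
  by rewrite -singular_value_sqr ltr_pXn2r ?nnegrE ?sqrtr_ge0 ?ltW ?lt_r.
have [//|tr_le0] := ltP 0 _.
rewrite leNgt => /negP[]; apply/bigmax_ltP; split => // k _.
rewrite ltNge; apply/negP => r_le; move: tr_le0.
rewrite (bigD1 k) //= indicE mem_set /=; last first.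
  rewrite in_itv /= andbT -singular_value_sqr.
  by rewrite ler_pXn2r ?nnegrE ?sqrtr_ge0 // ltW.
by apply/negP; rewrite -ltNge ltr_pwDl // sumr_ge0 // => j _; rewrite indicE.
Qed.

End RandomSpectrum.

(** * Pointwise bounds from L2 norms *)

Section L2Interval.
Variable R : realType.
Local Notation mu := (@lebesgue_measure R).
Local Notation "''N2' f" := ('N[mu]_(2%:E) [EFin \o f])%E (at level 0).
Implicit Types f : R -> R.

Lemma lebesgue_measure_cc (u v : R) : u <= v ->
  mu `[u, v]%classic = (v - u)%:E.
Proof.
rewrite le_eqVlt => /predU1P[->|uv].
  by rewrite set_itv1 lebesgue_measure_set1 subrr.
by rewrite lebesgue_measure_itv /= lte_fin uv EFinB.
Qed.

Lemma L2_indic_cc (u v : R) : u <= v ->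
  'N2 (\1_`[u, v]%classic) = (Num.sqrt (v - u))%:E.
Proof.
move=> uv; rewrite unlock.
under eq_integral => x _.
  rewrite (_ : (_ `^ 2)%E = (\1_`[u, v]%classic x)%:E); last first.
    rewrite /= indicE; case: (x \in _) => /=.
      by rewrite normr1 powR1.
    by rewrite normr0 powR0 // pnatr_eq0.
  over.
rewrite integral_indic ?setIT //; [|exact: measurable_itv..].
rewrite -powR12_sqrt ?subr_ge0 // -poweR_EFin; congr (_ `^ _)%E.
exact: lebesgue_measure_cc.
Qed.

(** The Cauchy-Schwarz inequality against the indicator of the interval. *)
Lemma integral_cc_le_L2 f (u v : R) : u <= v -> measurable_fun setT f ->
  (\int[mu]_(x in `[u, v]) `|f x|%:E <= (Num.sqrt (v - u))%:E * 'N2 f)%E.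
Proof.
move=> uv mf; rewrite -L2_indic_cc //.
have two_gt0 : (0 : R) < 2 by [].
have half2 : 2^-1 + 2^-1 = 1 :> R by lra.
have := @hoelder _ _ _ mu (\1_`[u, v]%classic) f 2 2
  (measurable_indic (measurable_itv _)) mf two_gt0 two_gt0 half2.
apply: le_trans.
rewrite Lnorm1 [X in (X <= _)%E]integral_mkcond /=.
rewrite le_eqVlt; apply/orP; left; apply/eqP; apply: eq_integral => x _.
rewrite /= patchE indicE; case: ifPn => xD /=.
  by rewrite mul1r.
by rewrite mul0r normr0.
Qed.

Lemma L2_ge_cc f (u v c : R) : u <= v -> 0 <= c -> measurable_fun setT f ->
  (forall x, x \in `[u, v] -> c <= `|f x|) ->
  ((Num.sqrt (v - u) * c)%:E <= 'N2 f)%E.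
Proof.
move=> uv c_ge0 mf c_le.
have mf2 : measurable_fun setT (fun x => `|(f x)%:E| `^ 2)%E.
  apply: (measurableT_comp (measurable_poweR 2)).
  by apply: measurableT_comp => //; exact/measurable_EFinP.
have int_le : (((v - u) * c ^+ 2)%:E <= \int[mu]_x (`|(f x)%:E| `^ 2))%E.
  apply: (@le_trans _ _ (\int[mu]_(x in `[u, v]) (`|(f x)%:E| `^ 2))%E);
    last first.
    by apply: ge0_subset_integral => // x _; exact: poweR_ge0.
  have -> : ((v - u) * c ^+ 2)%:E =
      (\int[mu]_(x in `[u, v]) (cst (c ^+ 2)%:E x))%E.
    rewrite integral_cst; last by exact: measurable_itv.
    rewrite mulrC EFinM; congr (_ * _)%E; apply/esym.
    exact: lebesgue_measure_cc.
  apply: ge0_le_integral => //.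
  - by move=> x _; rewrite /= lee_fin sqr_ge0.
  - by apply: measurable_funS mf2.
  - move=> x xuv; rewrite lee_fin powR_mulrn // lerXn2r ?nnegrE //.
    exact: c_le.
have -> : (Num.sqrt (v - u) * c)%:E = (((v - u) * c ^+ 2)%:E `^ 2^-1)%E.
  rewrite poweR_EFin powR12_sqrt ?mulr_ge0 ?subr_ge0 ?sqr_ge0 //.
  by rewrite sqrtrM ?subr_ge0 // sqrtr_sqr ger0_norm.
rewrite unlock; apply: gt0_ler_poweR; rewrite ?invr_ge0 //.
  by rewrite in_itv /= leey andbT lee_fin mulr_ge0 ?subr_ge0 ?sqr_ge0.
rewrite in_itv /= leey andbT.
by apply: integral_ge0.
Qed.

Lemma L2_eq0 f : measurable_fun setT f -> (forall x, x != 0 -> f x = 0) ->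
  'N2 f = 0%E.
Proof.
move=> mf f0; rewrite unlock.
have mf2 : measurable_fun setT (fun x => `|(f x)%:E| `^ 2)%E.
  apply: (measurableT_comp (measurable_poweR 2)).
  by apply: measurableT_comp => //; exact/measurable_EFinP.
have -> : (\int[mu]_x (`|(EFin \o f) x| `^ 2) = \int[mu]_x cst 0 x)%E.
  apply: ge0_ae_eq_integral => // [x _|]; first exact: poweR_ge0.
  exists [set 0]; split => //; first exact: lebesgue_measure_set1.
  move=> x /= /not_implyP[_ fx]; apply: contrapT => /eqP x0; apply: fx.
  by rewrite f0 // normr0 powR0 // pnatr_eq0.
by rewrite integral0 poweR0r // invr_eq0.
Qed.

Lemma measurable_continuous_off0 f :
  (forall x, x != 0 -> {for x, continuous f}) ->
  measurable_fun setT f.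
Proof.
move=> cf; rewrite -(setUv [set 0]).
apply/measurable_funU => //; first exact: measurableC.
split; first exact: measurable_fun_set1.
apply: open_continuous_measurable_fun.
  by apply: closed_openC; exact: closed_eq.
move=> x; rewrite inE => /eqP x0; exact: cf.
Qed.

(** On an interval of length [h] the function is at most its quadratic mean
    at some point, and varies from there by at most the integral of the
    derivative. *)
Lemma pointwise_le_L2 f (u v x : R) : u < v -> x \in `[u, v] ->
    measurable_fun setT f -> measurable_fun setT (derive1 f) ->
    (forall y, y \in `[u, v] -> derivable f y 1) ->
    (forall y, y \in `[u, v] -> {for y, continuous (derive1 f)}) ->
  (`|f x|%:E <= ((Num.sqrt (v - u))^-1)%:E * 'N2 f +
                (Num.sqrt (v - u))%:E * 'N2 (derive1 f))%E.
Proof.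
move=> uv xuv mf mf' df cf'.
have cf y : y \in `[u, v] -> {for y, continuous f}.
  move=> yuv; apply: differentiable_continuous.
  by apply/derivable1_diffP; exact: df.
have h_gt0 : 0 < Num.sqrt (v - u) by rewrite sqrtr_gt0 subr_gt0.
have [|y yuv y_min] := @EVT_min _ (fun z => `|f z|) _ _ (ltW uv).
  apply: continuous_in_subspaceT => z /set_mem /= zuv.
  by apply: cvg_norm; exact: cf.
have variation a b : u <= a -> a < b -> b <= v ->
    (`|f b - f a|%:E <= (Num.sqrt (v - u))%:E * 'N2 (derive1 f))%E.
  move=> ua ab bv.
  have sub z : z \in `[a, b] -> z \in `[u, v].
    by rewrite !in_itv /= => /andP[az zb]; rewrite (le_trans ua) ?(le_trans zb).
  apply: le_trans (integral_cc_le_L2 (ltW uv) mf').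
  have FTC : (\int[mu]_(z in `[a, b]) (derive1 f z)%:E = (f b)%:E - (f a)%:E)%E.
    apply: continuous_FTC2 => //.
      apply: continuous_in_subspaceT => z /set_mem /= zab.
      by apply: cf'; exact: sub.
    split=> [z zab||].
    - by apply: df; apply: sub; apply: subset_itv_oo_cc.
    - apply: cvg_at_right_filter; apply: cf; apply: sub.
      by rewrite in_itv /= lexx ltW.
    - apply: cvg_at_left_filter; apply: cf; apply: sub.
      by rewrite in_itv /= lexx ltW.
  have mi : measurable_fun `[a, b] (EFin \o derive1 f).
    by apply/measurable_EFinP; apply: measurable_funS mf'.
  rewrite -[X in (X <= _)%E]/(`|(f b)%:E - (f a)%:E|)%E -FTC.
  apply: (le_trans (le_abse_integral _ _ _)) => //.
  apply: ge0_subset_integral => //; try exact: measurable_itv.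
    by apply/measurable_EFinP; apply: measurableT_comp => //;
      apply: measurable_funS mf'.
have fy_le : (`|f y|%:E <= ((Num.sqrt (v - u))^-1)%:E * 'N2 f)%E.
  rewrite lee_pdivlMl //; rewrite -EFinM; apply: L2_ge_cc => //; exact: ltW.
have fxy : (`|f x - f y|%:E <= (Num.sqrt (v - u))%:E * 'N2 (derive1 f))%E.
  move: xuv yuv; rewrite !in_itv /= => /andP[ux xv] /andP[uy yv].
  have [xy|yx|->] := ltgtP x y.
  - by rewrite distrC; exact: variation.
  - exact: variation.
  - by rewrite subrr normr0 mule_ge0 ?lee_fin ?Lnorm_ge0.
apply: (le_trans _ (leeD fy_le fxy)); rewrite -EFinD lee_fin.
by rewrite -{1}[f x](subrK (f y)) addrC (le_trans (ler_normD _ _)) // addrC.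
Qed.

End L2Interval.

(** * The multiplier g *)

Section Multiplier.
Variables (R : realType) (r0 r1 nu : R).
Local Notation q := (g_quotient r0 r1 nu).
Local Notation gg := (g r0 r1 nu).
Implicit Types (t x y : R).

Definition g_num t : R :=
  expR ((1 - 2 * r1 * nu) * t / 2) - expR ((2 * r0 * nu - 1) * t / 2).
Definition g_den t : R := expR (t / 2) - expR (- t / 2).

Definition g_num' t : R :=
  (1 - 2 * r1 * nu) / 2 * expR ((1 - 2 * r1 * nu) * t / 2)
  - (2 * r0 * nu - 1) / 2 * expR ((2 * r0 * nu - 1) * t / 2).
Definition g_den' t : R := (expR (t / 2) + expR (- t / 2)) / 2.

Definition g_quotient' t : R :=
  (g_num' t * g_den t - g_num t * g_den' t) / g_den t ^+ 2.

Lemma g_den_neq0 t : t != 0 -> g_den t != 0.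
Proof.
move=> t0; rewrite subr_eq0; apply: contra t0 => /eqP /expR_inj E.
by apply/eqP; lra.
Qed.

Lemma is_derive_expR_linear (k t : R) :
  is_derive t 1 (fun x => expR (k * x / 2)) (k / 2 * expR (k * t / 2)).
Proof.
have d : is_derive t (1 : R) (fun x : R => k * x / 2) (k / 2).
  rewrite (_ : (fun x => _) = (k / 2) \*: (@id R)); last first.
    by apply/funext => x /=; rewrite mulrAC.
  by rewrite -[X in is_derive _ _ _ X]mulr1; exact: is_deriveZ.
have := @is_derive1_comp _ expR (fun x => k * x / 2) t _ _
  (is_derive_expR (k * t / 2)) d.
by rewrite /GRing.scale /= mulrC.
Qed.

Lemma is_derive_g_num t : is_derive t 1 g_num (g_num' t).
Proof. apply: is_deriveB; exact: is_derive_expR_linear. Qed.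

Lemma is_derive_g_den t : is_derive t 1 g_den (g_den' t).
Proof.
have -> : g_den = (fun x => expR (1 * x / 2)) - (fun x => expR (- 1 * x / 2)).
  by apply/funext => x; rewrite /g_den !fctE mul1r mulN1r.
have -> : g_den' t = 1 / 2 * expR (1 * t / 2) - (-1) / 2 * expR (-1 * t / 2).
  by rewrite /g_den' !mul1r !mulN1r; field.
apply: is_deriveB; exact: is_derive_expR_linear.
Qed.

Lemma is_derive_g_quotient t : t != 0 -> is_derive t 1 q (g_quotient' t).
Proof.
move=> t0; have D0 := g_den_neq0 t0.
have -> : q = g_num * (fun x => (g_den x)^-1) by apply/funext.
apply: (is_derive_eq (is_deriveM (is_derive_g_num t)
  (is_deriveV D0 (is_derive_g_den t)))).
rewrite /GRing.scale /= /g_quotient'; field.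
exact: D0.
Qed.

Lemma near_neq0 t : t != 0 -> \forall x \near t, x != 0.
Proof.
by move=> t0; apply: open_nbhs_nbhs; split; [exact: open_neq|].
Qed.

Lemma is_derive_g t : t != 0 -> is_derive t 1 gg (g_quotient' t).
Proof.
move=> t0; have := is_derive_g_quotient t0.
apply: near_eq_is_derive => //.
near=> x; rewrite /g ifF //; apply/negbTE; near: x; exact: near_neq0.
Unshelve. all: by end_near.
Qed.

Lemma continuous_g t : t != 0 -> {for t, continuous gg}.
Proof.
move=> /is_derive_g[dg _]; apply: differentiable_continuous.
exact/derivable1_diffP.
Qed.

Lemma continuous_derive1_g t : t != 0 -> {for t, continuous (derive1 gg)}.
Proof.
move=> t0; have cE k : expR (k * x / 2) @[x --> t] --> expR (k * t / 2).
  have [dE _] := is_derive_expR_linear k t.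
  suff: {for t, continuous (fun x => expR (k * x / 2))} by [].
  by apply: differentiable_continuous; apply/derivable1_diffP.
have cE' : expR (x / 2) @[x --> t] --> expR (t / 2).
  by have := cE 1; under eq_fun do rewrite mul1r; rewrite mul1r.
have cE'' : expR (- x / 2) @[x --> t] --> expR (- t / 2).
  by have := cE (-1); under eq_fun do rewrite mulN1r; rewrite mulN1r.
have dgE x : x != 0 -> derive1 gg x = g_quotient' x.
  by move=> x0; rewrite derive1E; have [_ ->] := is_derive_g x0.
rewrite /prop_for /continuous_at dgE //.
suff : g_quotient' x @[x --> t] --> g_quotient' t.
  apply: cvg_trans; apply: near_eq_cvg.
  near=> x; rewrite dgE //; near: x; exact: near_neq0.
have cD : g_den x @[x --> t] --> g_den t by exact: cvgB.
have cD' : g_den' x @[x --> t] --> g_den' t by apply: cvgMl; exact: cvgD.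
have cN : g_num x @[x --> t] --> g_num t by apply: cvgB; exact: cE.
have cN' : g_num' x @[x --> t] --> g_num' t.
  by apply: cvgB; apply: cvgMr; exact: cE.
apply: cvgM; first by apply: cvgB; exact: cvgM.
apply: cvgV; first by rewrite expf_neq0 // g_den_neq0.
by under eq_fun do rewrite expr2; rewrite expr2; exact: cvgM.
Unshelve. all: by end_near.
Qed.

Lemma measurable_g : measurable_fun setT gg.
Proof. by apply: measurable_continuous_off0; exact: continuous_g. Qed.

Lemma measurable_derive1_g : measurable_fun setT (derive1 gg).
Proof. by apply: measurable_continuous_off0; exact: continuous_derive1_g. Qed.

Local Notation mu := (@lebesgue_measure R).

(** The intervals chosen lie on the side of [0] where [t] is, so the removable
    singularity of [g] is avoided. *)
Lemma g_le_g_bound c t : 0 < c -> t != 0 ->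
  (`|gg t|%:E <= g_bound r0 r1 nu c)%E.
Proof.
move=> c_gt0 t0.
have [u [v [uv tuv uv0]]] : exists u v, [/\ v - u = c^-1, t \in `[u, v] &
    forall y, y \in `[u, v] -> y != 0].
  have ci : 0 < c^-1 by rewrite invr_gt0.
  have [t_lt0|t_gt0] := ltP t 0.
    exists (t - c^-1), t; split; first by lra.
      by rewrite in_itv /= lexx andbT; lra.
    move=> y; rewrite in_itv /= => /andP[_ yt].
    by rewrite lt_eqF ?(le_lt_trans yt).
  have {}t_gt0 : 0 < t by rewrite lt_neqAle eq_sym t0.
  exists t, (t + c^-1); split; first by lra.
    by rewrite in_itv /= lexx /=; lra.
  move=> y; rewrite in_itv /= => /andP[ty _].
  by rewrite gt_eqF ?(lt_le_trans _ ty).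
have u_lt_v : u < v by rewrite -subr_gt0 uv invr_gt0.
have := pointwise_le_L2 u_lt_v tuv measurable_g measurable_derive1_g.
rewrite uv sqrtrV ?invrK; last exact: ltW.
move=> /(_ _ _)/le_trans; apply.
- by move=> y /uv0 /is_derive_g[].
- by move=> y /uv0; exact: continuous_derive1_g.
apply: leeD; apply: lee_wpmul2r; rewrite ?Lnorm_ge0 // lee_fin.
  by rewrite ler_sqrt; lra.
have ci_gt0 : 0 < c^-1 by rewrite invr_gt0.
by rewrite -(sqrtrV (ltW c_gt0)) ler_sqrt; lra.
Qed.

Lemma g_bound_ge0 c : (0 <= g_bound r0 r1 nu c)%E.
Proof. by rewrite adde_ge0 // mule_ge0 ?Lnorm_ge0 // lee_fin. Qed.

Lemma L2_g_eq0 : (forall t, t != 0 -> gg t = 0) ->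
  'N[mu]_(2%:E) [EFin \o gg]%E = 0%E /\
  'N[mu]_(2%:E) [EFin \o derive1 gg]%E = 0%E.
Proof.
move=> g0; split; first by apply: L2_eq0 => //; exact: measurable_g.
apply: L2_eq0 => [|t t0]; first exact: measurable_derive1_g.
rewrite derive1E (near_eq_derive (g := cst 0)) ?derive_cst //.
near=> x; rewrite g0 //; near: x; exact: near_neq0.
Unshelve. all: by end_near.
Qed.

End Multiplier.

(** * Size of g and the minimum over c *)

Section Minimum.
Variables (R : realType) (r0 r1 nu : R).
Local Notation q := (g_quotient r0 r1 nu).
Local Notation gg := (g r0 r1 nu).
Local Notation mu := (@lebesgue_measure R).
Implicit Types (c t x y : R).

(** The exponents of the numerator lie between those of the denominator: with
    [p = 2 r0 nu - 1] and [s = 1 - 2 r1 nu], the hypotheses give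
    [- 1 <= p <= s <= 1]. *)
Lemma g_quotient_norm_le1 t : 0 <= nu -> nu <= 1 -> 0 <= r0 -> 0 <= r1 ->
  r0 + r1 = 1 -> t != 0 -> `|q t| <= 1.
Proof.
move=> nu_ge0 nu_le1 r0_ge0 r1_ge0 r01 t0.
have D0 : expR (t / 2) - expR (- t / 2) != 0 :> R by exact: g_den_neq0.
have p0 : 0 <= r0 * nu by exact: mulr_ge0.
have p1 : 0 <= r1 * nu by exact: mulr_ge0.
have p01 : r0 * nu + r1 * nu <= 1 by rewrite -mulrDl r01 mul1r.
rewrite /g_quotient normrM normfV ler_pdivrMr ?normr_gt0 // mul1r.
have [t_lt0|t_ge0] := ltP t 0.
  rewrite !ler0_norm ?subr_le0 ?ler_expR ?lerN2; [|nra..].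
  by apply: lerB; rewrite ler_expR; nra.
rewrite !ger0_norm ?subr_ge0 ?ler_expR; [|nra..].
by apply: lerB; rewrite ler_expR; nra.
Qed.

(** With [x = expR u], [y = expR v] and [t = u - v], both sides carry the factor
    [expR ((u + v) / 2)], up to which the identity is the definition of [q]. *)
Lemma powR_divided_difference x y : 0 < x -> 0 < y -> x != y ->
  r0 + r1 = 1 ->
  x * x `^ (- nu) - y * y `^ (- nu) =
  q (ln x - ln y) * (x `^ (- (r0 * nu)) * (x - y) * y `^ (- (r1 * nu))).
Proof.
move=> x_gt0 y_gt0 xy r01; have r1E : r1 = 1 - r0 by lra.
set u := ln x; set v := ln y.
have t0 : u - v != 0.
  by rewrite subr_eq0; apply: contra xy => /eqP /ln_inj ->.
have xE : x = expR u by rewrite lnK.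
have yE : y = expR v by rewrite lnK.
have D0 := g_den_neq0 t0.
have E2 : x - y = expR ((u + v) / 2) *
    (expR ((u - v) / 2) - expR (- (u - v) / 2)).
  by rewrite mulrBr -!expRD xE yE; congr (expR _ - expR _); field.
rewrite E2 xE yE -!expRM -!expRD /g_quotient.
rewrite [RHS](_ : _ =
  (expR ((1 - 2 * r1 * nu) * (u - v) / 2) -
   expR ((2 * r0 * nu - 1) * (u - v) / 2)) *
  (expR (u * - (r0 * nu)) * expR ((u + v) / 2) * expR (v * - (r1 * nu)))).
  by rewrite -!expRD mulrBl -!expRD r1E; congr (expR _ - expR _); field.
by field.
Qed.

Lemma multiplier_bound (G : R) : 0 <= G -> r0 + r1 = 1 ->
    (forall t, t != 0 -> `|q t| <= G) ->
  forall x y, 0 < x -> 0 < y -> `|x * x `^ (- nu) - y * y `^ (- nu)| <=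
    G * `|x `^ (- (r0 * nu)) * (x - y) * y `^ (- (r1 * nu))|.
Proof.
move=> G_ge0 r01 qG x y x_gt0 y_gt0; have [->|xy] := eqVneq x y.
  by rewrite !subrr normr0 mulr_ge0.
rewrite powR_divided_difference // normrM ler_wpM2r // qG // subr_eq0.
by apply: contra xy => /eqP /ln_inj ->.
Qed.

(** One of the two terms of [g_bound] is absent when its norm vanishes, and the
    other can be made arbitrarily small through [c]. *)
Lemma g_eq0_of_le (K : R) :
    (forall t, t != 0 -> forall s, 0 < s -> `|gg t| <= s * K) ->
  forall t, t != 0 -> gg t = 0.
Proof.
move=> le_K t t0; apply/eqP; rewrite -normr_le0; apply/ler_addgt0Pr => e e_gt0.
rewrite add0r; have K_ge0 : 0 <= K.
  by have := le_K t t0 1 ltr01; rewrite mul1r; apply: le_trans.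
have := le_K t t0 (e / (K + 1)); rewrite divr_gt0 ?ltr_wpDl //.
move=> /(_ isT) /le_trans; apply.
rewrite mulrAC -mulrA ler_piMr ?(ltW e_gt0) //.
by rewrite ler_pdivrMr ?ltr_wpDl // mul1r lerDl.
Qed.

(** Let [a] be the norm of [g] and [b] that of its derivative.  With
    [s = sqrt c], the bound is [sqrt 2 * (s a + b / s)], which is minimal at
    [s ^ 2 = b / a].  If [a] or [b] vanishes, letting [c] tend to infinity or [0]
    in the pointwise bound shows that [g] vanishes off [0], so that both
    vanish. *)
Lemma g_bound_minimum : exists2 m : \bar R,
  is_minimum [set g_bound r0 r1 nu c | c in [set c : R | 0 < c]] m &
  m = +oo%E \/ exists2 G : R, m = G%:E & forall t, t != 0 -> `|gg t| <= G.
Proof.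
have bound c t := @g_le_g_bound R r0 r1 nu c t.
suff [c0 c0_gt0 min_c0] : exists2 c0 : R, 0 < c0 &
    forall c, 0 < c -> (g_bound r0 r1 nu c0 <= g_bound r0 r1 nu c)%E.
  exists (g_bound r0 r1 nu c0).
    split; first by exists c0.
    by move=> _ [c c_gt0 <-]; exact: min_c0.
  have := g_bound_ge0 r0 r1 nu c0.
  have := bound c0.
  case: (g_bound r0 r1 nu c0) => [G| |] // boundG _; [right|left] => //.
  by exists G => // t t0; rewrite -lee_fin boundG.
move: bound; rewrite /g_bound.
have := @L2_g_eq0 R r0 r1 nu.
have := @Lnorm_ge0 _ _ _ mu 2%:E (EFin \o gg).
have := @Lnorm_ge0 _ _ _ mu 2%:E (EFin \o derive1 gg).
have cst_min (F : R -> \bar R) (x : \bar R) : (forall c, 0 < c -> F c = x) ->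
    exists2 c0 : R, 0 < c0 & forall c, 0 < c -> (F c0 <= F c)%E.
  by move=> Fx; exists 1 => // c c_gt0; rewrite !Fx.
case: 'N[mu]_(2%:E) [EFin \o gg]%E => [a| |] //; last first.
  move=> b_ge0 _ _ _; apply: (cst_min _ +oo%E) => c c_gt0.
  rewrite gt0_muley ?lte_fin ?sqrtr_gt0 ?mulr_gt0 // addye // -ltNye.
  by rewrite (lt_le_trans ltNy0) // mule_ge0 // lee_fin.
case: 'N[mu]_(2%:E) [EFin \o derive1 gg]%E => [b| |] //; last first.
  move=> _ _ _ _; apply: (cst_min _ +oo%E) => c c_gt0.
  by rewrite gt0_muley ?lte_fin ?sqrtr_gt0 ?divr_gt0 // addey.
rewrite !lee_fin => b_ge0 a_ge0 L2_0 bound.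
have {}bound c t : 0 < c -> t != 0 ->
    `|gg t| <= Num.sqrt (2 * c) * a + Num.sqrt (2 / c) * b.
  by move=> c_gt0 t0; have := bound c t c_gt0 t0; rewrite -!EFinM -EFinD lee_fin.
have g0_min : (forall t, t != 0 -> gg t = 0) -> exists2 c0 : R, 0 < c0 &
    forall c, 0 < c -> ((Num.sqrt (2 * c0))%:E * a%:E
      + (Num.sqrt (2 / c0))%:E * b%:E <=
      (Num.sqrt (2 * c))%:E * a%:E + (Num.sqrt (2 / c))%:E * b%:E)%E.
  move=> g0; have [-> ->] := L2_0 g0.
  by apply: (cst_min (fun c => _ * 0 + _ * 0)%E 0%E) => c _; rewrite !mule0 adde0.
(* [c = 2 / s ^ 2] makes the coefficient [sqrt (2 / c)] equal to [s] *)
have [a0|a_neq0] := eqVneq a 0.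
  apply: g0_min; apply: (@g_eq0_of_le b) => t t0 s s_gt0.
  have := bound (2 / s ^+ 2) t; rewrite divr_gt0 ?exprn_gt0 // => /(_ isT t0).
  rewrite a0 mulr0 add0r (_ : 2 / (2 / s ^+ 2) = s ^+ 2); last first.
    by field; rewrite gt_eqF.
  by rewrite sqrtr_sqr (gtr0_norm s_gt0).
(* [c = s ^ 2 / 2] makes the coefficient [sqrt (2 * c)] equal to [s] *)
have [b0|b_neq0] := eqVneq b 0.
  apply: g0_min; apply: (@g_eq0_of_le a) => t t0 s s_gt0.
  have := bound (s ^+ 2 / 2) t; rewrite divr_gt0 ?exprn_gt0 // => /(_ isT t0).
  rewrite b0 mulr0 addr0 (_ : 2 * (s ^+ 2 / 2) = s ^+ 2); last by field.
  by rewrite sqrtr_sqr (gtr0_norm s_gt0).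
have a_gt0 : 0 < a by rewrite lt_neqAle eq_sym a_neq0.
have b_gt0 : 0 < b by rewrite lt_neqAle eq_sym b_neq0.
exists (b / a) => [|c c_gt0]; first exact: divr_gt0.
rewrite -!EFinM -!EFinD lee_fin !(@sqrtrM _ 2) ?ler0n //.
rewrite !sqrtrV ?divr_ge0 ?(ltW c_gt0) //.
have s0_gt0 : 0 < Num.sqrt (b / a) by rewrite sqrtr_gt0 divr_gt0.
have bE : b = Num.sqrt (b / a) ^+ 2 * a.
  by rewrite sqr_sqrtr ?divr_ge0 // divfK.
have s_gt0 : 0 < Num.sqrt c by rewrite sqrtr_gt0.
have r_gt0 : 0 < Num.sqrt 2 :> R by rewrite sqrtr_gt0.
move: s0_gt0 bE s_gt0 r_gt0.
move: (Num.sqrt (b / a)) (Num.sqrt c) (Num.sqrt 2).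
move=> s0 s r s0_gt0 -> s_gt0 r_gt0.
rewrite -subr_ge0.
rewrite (_ : _ - _ = r * a * (s - s0) ^+ 2 / s); last first.
  by field; rewrite !gt_eqF.
by rewrite divr_ge0 ?(ltW s_gt0) // mulr_ge0 ?sqr_ge0 // mulr_ge0 // ltW.
Qed.

End Minimum.

(** * The tail bound *)

(** Markov's inequality for [y], after replacing [y] by its bound [K * z]. *)
Lemma tail_le_expectation (R : realType) (d : measure_display)
    (Omega : measurableType d) (P : probability Omega R) (y z : Omega -> R)
    (K theta : R) : measurable_fun setT y -> measurable_fun setT z ->
    (forall w, 0 <= z w) -> 0 <= K -> 0 < theta ->
    (forall w, y w <= K * z w) ->
  (P [set w | (theta <= y w)%R] <= (K / theta)%:E * 'E_P[z])%E.
Proof.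
move=> my mz z_ge0 K_ge0 theta_gt0 yz.
have mS : measurable [set w | (theta <= y w)%R].
  rewrite (_ : [set w | _] = y @^-1` `[theta, +oo[%classic).
    by rewrite -[X in measurable X]setTI; apply: my => //; exact: measurable_itv.
  by apply/seteqP; split=> w /=; rewrite in_itv /= andbT.
have mz' : measurable_fun setT (EFin \o z) by exact/measurable_EFinP.
rewrite unlock -ge0_integralZl //; last first.
- by rewrite lee_fin divr_ge0 // ltW.
- by move=> w _; rewrite lee_fin.
rewrite -[X in P X]setIT -integral_indic //.
apply: ge0_le_integral => //.
- by apply/measurable_EFinP; exact: measurable_indic.
- exact: measurable_funeM.
move=> w _; rewrite -EFinM lee_fin indicE; case: (boolP (w \in _)) => /=.
  rewrite inE /= => theta_le.
  by rewrite mulrAC ler_pdivlMr // mul1r (le_trans theta_le).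
by rewrite mulr_ge0 // divr_ge0 // ltW.
Qed.

Theorem theorem4 (R : realType) (d : measure_display)
    (Omega : measurableType d) (P : probability Omega R)
    (N : nat) (I : 'I_N -> nat) (N_gt0 : (0 < N)%N)
    (I_gt0 : forall k, (0 < I k)%N)
    (A B : Omega -> tensor R I I) (X : tensor R I I)
    (A_random : random_tensor A) (B_random : random_tensor B)
    (A_posdef : forall w, posdef (A w)) (B_posdef : forall w, posdef (B w))
    (X_hermitian : hermitian_tensor X)
    (nu r0 r1 theta : R) (nu_ge0 : 0 <= nu) (nu_le1 : nu <= 1)
    (r0_ge0 : 0 <= r0) (r1_ge0 : 0 <= r1) (r0Dr1 : r0 + r1 = 1)
    (theta_gt0 : 0 < theta) :
  exists2 m : \bar R,
    is_minimum [set g_bound r0 r1 nu c | c in [set c : R | 0 < c]] m &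
    (P [set w | (theta <= spectral_norm
                   (commutator (A w ⋆ tpow (tabs (A w)) (- nu)) (B w)))%R]
     <= ((dimprod I)%:R ^+ 2 / theta)%:E * m *
        'E_P[fun w => spectral_norm
               (tpow (tabs (A w)) (- (r0 * nu)) ⋆ commutator (A w) (B w)
                ⋆ tpow (tabs (A w)) (- (r1 * nu)))%R])%E.

Proof.
pose y w := spectral_norm (commutator (A w ⋆ tpow (tabs (A w)) (- nu)) (B w)).
pose z w := spectral_norm (tpow (tabs (A w)) (- (r0 * nu))
  ⋆ commutator (A w) (B w) ⋆ tpow (tabs (A w)) (- (r1 * nu))).
have A_hermitian w : hermitian_tensor (A w) by have [] := A_posdef w.
have mabs : random_tensor (fun w => tabs (A w)).
  rewrite (_ : (fun w => _) = A) //; apply/funext => w; exact: tabs_posdef.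
have habs w : hermitian_tensor (tabs (A w)) by rewrite tabs_posdef.
have mpow p : random_tensor (fun w => tpow (tabs (A w)) p) by exact: random_tpow.
have my : measurable_fun setT y.
  apply: measurable_spectral_norm; apply: random_commutator => //.
  exact: random_einstein.
have mz : measurable_fun setT z.
  apply: measurable_spectral_norm; apply: random_einstein => //.
  apply: random_einstein => //; exact: random_commutator.
have z_ge0 w : 0 <= z w by exact: spectral_norm_ge0.
have tail (G : R) : 0 <= G ->
    (forall t, t != 0 -> `|g_quotient r0 r1 nu t| <= G) ->
    (P [set w | (theta <= y w)%R] <=
       (Num.sqrt (dimprod I)%:R * G / theta)%:E * 'E_P[z])%E.
  move=> G_ge0 qG; apply: tail_le_expectation => // [|w].
    by rewrite mulr_ge0 // sqrtr_ge0.
  apply: commutator_spectral_norm_le => //.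
  exact: multiplier_bound.
have n_gt0 : (0 < dimprod I)%N by rewrite prodn_gt0.
have E_ge0 : (0 <= 'E_P[z])%E.
  by rewrite unlock integral_ge0 // => w _; rewrite lee_fin.
have [m m_min m_bound] := g_bound_minimum r0 r1 nu; exists m => //.
case: m_bound => [->|[G -> gG]].
  (* infinite minimum: [`|g| <= 1] keeps the case of a zero expectation *)
  have := tail 1 ler01
    (fun t => g_quotient_norm_le1 nu_ge0 nu_le1 r0_ge0 r1_ge0 r0Dr1).
  move=> /le_trans; apply; apply: lee_wpmul2r => //.
  by rewrite gt0_muley ?leey // lte_fin divr_gt0 // exprn_gt0 // ltr0n.
have qG t : t != 0 -> `|g_quotient r0 r1 nu t| <= G.
  by move=> t0; have := gG t t0; rewrite /g (negbTE t0).
have G_ge0 : 0 <= G by apply: le_trans (qG 1 (oner_neq0 _)).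
apply: (le_trans (tail G G_ge0 qG)); apply: lee_wpmul2r => //.
rewrite -EFinM lee_fin [leRHS]mulrAC ler_wpM2r ?invr_ge0 ?(ltW theta_gt0) //.
rewrite ler_wpM2r //.
have sqrt_le (n : R) : 1 <= n -> Num.sqrt n <= n ^+ 2.
  move=> n_ge1; have n_ge0 : 0 <= n by rewrite (le_trans ler01).
  rewrite -[leRHS](@ger0_norm _ (n ^+ 2)) ?sqr_ge0 // -sqrtr_sqr ler_wsqrtr //.
  rewrite -exprM -[leLHS]expr1; exact: ler_weXn2l.
by apply: sqrt_le; rewrite ler1n.
Qed.
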